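(* Let $\mathcal G$ be the graph with vertex set $V=(\mathbb{N}\times\mathbb{N})\setminus\{(0,0)\}$ (where $\mathbb{N}=\{0,1,2,\dots\}$), in which two distinct vertices $(a,b),(c,d)$ are adjacent if and only if $a=c=0$, or $b=d=0$, or ($a<c$ and $b>d$), or ($a>c$ and $b<d$). Then $\mathcal G$ is cop-win. Furthermore, for any two vertices $u,v$ of $\mathcal G$ there exists $n\in\mathbb{N}$ such that if the cop is at $v$ and the robber is at $u$, with the robber to make the next move, the cop can catch the robber in at most $n$ turns. However, there is no $n\in\mathbb{N}$ such that this holds for all pairs of positions $u,v$.
   Context: The game of cops and robbers on a graph $G$: the cop chooses a starting vertex, then the robber chooses a starting vertex; then they alternately move, the cop moving first, where a move consists of moving to an adjacent vertex or staying put. The cop wins if at some point he occupies the same vertex as the robber. $G$ is cop-win if the cop has a winning strategy. *)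

(* Defs.v *)
From mathcomp Require Import all_boot.

Set Implicit Arguments.
Unset Strict Implicit.
Unset Printing Implicit Defensive.

Record graph := Graph {
  vertex :> Type;
  adj : rel vertex;
  adj_sym : symmetric adj;
  adj_irr : irreflexive adj
}.

Section CopsAndRobbers.

Variable G : graph.

Definition move (x y : G) : Prop := x = y \/ adj x y.

Definition robber_play (r : nat -> G) : Prop := forall n, move (r n) (r n.+1).

(* A play is a sequence of positions c 0, r 0, c 1, r 1, c 2, ... taken        *)
(* alternately by the cop and the robber. A cop strategy gives the next cop    *)
(* position from the robber positions r 0, ..., r (n - 1) seen so far (his own *)
(* past positions are then determined); its value on the empty history is the  *)
(* cop's initial position.                                                     *)
Definition strategy := seq G -> G.

Definition cop_play (s : strategy) (r : nat -> G) (n : nat) : G :=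
  s (mkseq r n).

Definition legal_against (s : strategy) (r : nat -> G) : Prop :=
  forall n, move (cop_play s r n) (cop_play s r n.+1).

(* The robber's vertex r n is compared with the cop's vertices just before and *)
(* just after it in the play.                                                  *)
Definition caught_at (s : strategy) (r : nat -> G) (n : nat) : Prop :=
  cop_play s r n = r n \/ cop_play s r n.+1 = r n.

Definition cop_win : Prop :=
  exists s : strategy, forall r : nat -> G, robber_play r ->
    legal_against s r /\ exists n, caught_at s r n.

(* Cop at v, robber at u, robber to move: c 0 = v, and r 0 is the robber's     *)
(* position after his first move from u. Turn k is the robber's move to r k    *)
(* followed by the cop's move to c (k + 1).                                    *)
Definition can_catch_within (n : nat) (v u : G) : Prop :=
  exists s : strategy, s [::] = v /\
    forall r : nat -> G, move u (r 0) -> robber_play r ->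
      legal_against s r /\ (v = u \/ exists2 k, k < n & caught_at s r k).

End CopsAndRobbers.

Definition gridV : Type := {p : nat * nat | p != (0, 0)}.

Definition grid_adj : rel gridV := fun u v =>
  let: (a, b) := val u in
  let: (c, d) := val v in
  (u != v) && [|| (a == 0) && (c == 0), (b == 0) && (d == 0),
                  (a < c) && (b > d) | (a > c) && (b < d)].

Lemma grid_adj_sym : symmetric grid_adj.
Proof.
move=> u v; rewrite /grid_adj eq_sym.
case: (val u) => a b; case: (val v) => c d.
congr (_ && _); rewrite (andbC (c == 0)) (andbC (d == 0)).
by congr [|| _, _ | _]; rewrite orbC.
Qed.

Lemma grid_adj_irr : irreflexive grid_adj.
Proof. by move=> u; rewrite /grid_adj eqxx; case: (val u). Qed.

Definition gridG : graph := Graph grid_adj_sym grid_adj_irr.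

(* Main.v *)
Require Import Defs.
From mathcomp Require Import all_boot.
From mathcomp Require Import zify.

(** The axes form a clique, and every vertex has neighbours arbitrarily far out
on each axis. A cop at (0, Y) with Y above the robber's second coordinate
threatens the robber and all his escapes except those that decrease his
first coordinate. Moving ever higher on the vertical axis, the cop therefore
wins within a number of turns bounded by the robber's first coordinate, and
symmetrically for the second. One robber move from (a, b) cannot increase both
coordinates, so the cop picks the axis after seeing it and wins within
max(a, b) + 2 turns. Conversely, a robber threatened at (a, b) by a cop at
(x, y) with a < x and y < b is safe at (x + 1, b - 1), and symmetrically; this
lowers the smaller coordinate by at most one, so from (n + 2, n + 2) he survives
n turns. *)

Implicit Types (u v w : gridV) (r : nat -> gridV).

Definition coord1 u : nat := (val u).1.
Definition coord2 u : nat := (val u).2.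

Lemma coord_neq0 u : (coord1 u != 0) || (coord2 u != 0).
Proof. by rewrite -negb_and; exact: (valP u). Qed.

Lemma coord_eqE u v :
  (u == v) = (coord1 u == coord1 v) && (coord2 u == coord2 v).
Proof.
by rewrite -val_eqE /coord1 /coord2; case: (val u); case: (val v).
Qed.

Lemma coord_inj u v : coord1 u = coord1 v -> coord2 u = coord2 v -> u = v.
Proof. by move=> e1 e2; apply/eqP; rewrite coord_eqE e1 e2 !eqxx. Qed.

Lemma grid_adjE u v :
  grid_adj u v =
  ((coord1 u != coord1 v) || (coord2 u != coord2 v)) &&
  [|| (coord1 u == 0) && (coord1 v == 0), (coord2 u == 0) && (coord2 v == 0),
      (coord1 u < coord1 v) && (coord2 u > coord2 v) |
      (coord1 u > coord1 v) && (coord2 u < coord2 v)].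
Proof.
rewrite /grid_adj coord_eqE negb_and /coord1 /coord2.
by case: (val u) => a b; case: (val v).
Qed.

Lemma vertexSl_proof a b : (a.+1, b) != (0, 0). Proof. by []. Qed.
Lemma vertexSr_proof a b : (a, b.+1) != (0, 0).
Proof. by rewrite xpair_eqE andbF. Qed.

Definition vertexSl a b : gridV := exist _ (a.+1, b) (vertexSl_proof a b).
Definition vertexSr a b : gridV := exist _ (a, b.+1) (vertexSr_proof a b).

Lemma swap_proof u : (coord2 u, coord1 u) != (0, 0).
Proof. by rewrite xpair_eqE negb_and orbC coord_neq0. Qed.

Definition swap u : gridV := exist _ (coord2 u, coord1 u) (swap_proof u).

Definition coordE :=
  (fun a b => erefl : coord1 (vertexSl a b) = a.+1,
   fun a b => erefl : coord2 (vertexSl a b) = b,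
   fun a b => erefl : coord1 (vertexSr a b) = a,
   fun a b => erefl : coord2 (vertexSr a b) = b.+1,
   fun u => erefl : coord1 (swap u) = coord2 u,
   fun u => erefl : coord2 (swap u) = coord1 u).

Lemma swapK : involutive swap.
Proof. by move=> u; apply: coord_inj. Qed.

Lemma swap_adj u v : grid_adj (swap u) (swap v) = grid_adj u v.
Proof. by rewrite !grid_adjE !coordE; apply/idP/idP; lia. Qed.

Lemma swap_move (u v : gridG) : move u v -> @move gridG (swap u) (swap v).
Proof. by case=> [->|uv]; [left | right; rewrite /= swap_adj]. Qed.

(** The fallback vertex lies strictly above the cop, so it is his neighbour wherever he stands, and
    strictly above the robber, which creates the threat. *)
Definition climb_step v u : gridV :=
  if grid_adj v u then u else
  if v == u then u else vertexSr 0 (maxn (coord2 v) (coord2 u)).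

Definition climb v : strategy gridG := foldl climb_step v.

Lemma climb_playS v r n :
  cop_play (climb v) r n.+1 = climb_step (cop_play (climb v) r n) (r n).
Proof. by rewrite /cop_play /climb mkseqS -cats1 foldl_cat. Qed.

Lemma climb_legal v r : legal_against (climb v) r.
Proof.
move=> n; rewrite climb_playS; move: (cop_play _ _ _) => w.
rewrite /climb_step; case: ifP => [|_]; first by right.
case: eqP => [|_]; first by left.
by right; rewrite /= grid_adjE !coordE; lia.
Qed.

(** A robber out of reach of a cop on the vertical axis is off that axis and at least as high as the
    cop, so he has just risen; such a move must lower his first coordinate. *)
Lemma climb_progress v r k : @robber_play gridG r ->
  (exists2 j, j <= k & caught_at (climb v) r j) \/
  [/\ coord1 (r k) + k <= coord1 (r 0),
      coord1 (cop_play (climb v) r k.+1) = 0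
    & coord2 (r k) < coord2 (cop_play (climb v) r k.+1)].
Proof.
move=> rP; elim: k => [|k IHk].
  rewrite climb_playS; set c := cop_play _ _ _.
  case: (boolP (climb_step c (r 0) == r 0)) => [/eqP e|].
    by left; exists 0 => //; right; rewrite climb_playS.
  rewrite /climb_step; case: ifP => _; rewrite ?eqxx //.
  case: ifP => _; rewrite ?eqxx // => _.
  by right; rewrite !coordE; split; lia.
case: IHk => [[j jk cj]|[le1 c1 c2]]; first by left; exists j => //; lia.
rewrite climb_playS; move: c1 c2; set c := cop_play _ _ _ => c1 c2.
case: (boolP (climb_step c (r k.+1) == r k.+1)) => [/eqP e|].
  by left; exists k.+1 => //; right; rewrite climb_playS.
rewrite /climb_step; case: ifPn => [|nadj]; rewrite ?eqxx //.
case: ifPn => [|ncr]; rewrite ?eqxx // => _.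
right; rewrite !coordE; split=> //; last by lia.
move: ncr nadj (coord_neq0 (r k.+1)); rewrite coord_eqE grid_adjE.
by case: (rP k) => [<-|/=]; rewrite ?grid_adjE; lia.
Qed.

Lemma climb_catches v r : @robber_play gridG r ->
  exists2 k, k < (coord1 (r 0)).+2 & caught_at (climb v) r k.
Proof.
(* At this index the second alternative would need a negative first coordinate. *)
by move=> rP; case: (climb_progress v r (coord1 (r 0)).+1 rP) => // -[]; lia.
Qed.

(** Conjugation by the automorphism [swap] transfers the bound to the second coordinate. *)
Definition climb_right v : strategy gridG :=
  fun h => swap (climb (swap v) (map swap h)).

Lemma climb_right_play v r n :
  cop_play (climb_right v) r n = swap (cop_play (climb (swap v)) (swap \o r) n).
Proof. by rewrite /cop_play /climb_right /mkseq -map_comp. Qed.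

Lemma climb_right_legal v r : legal_against (climb_right v) r.
Proof.
move=> n; rewrite !climb_right_play.
by apply: swap_move; apply: climb_legal.
Qed.

Lemma climb_right_catches v r : @robber_play gridG r ->
  exists2 k, k < (coord2 (r 0)).+2 & caught_at (climb_right v) r k.
Proof.
move=> rP; have sP : @robber_play gridG (swap \o r).
  by move=> n; apply: swap_move; apply: rP.
have [k lek ck] := climb_catches (swap v) (swap \o r) sP.
exists k => //; rewrite /caught_at !climb_right_play.
by case: ck => ->; rewrite /= swapK; [left | right].
Qed.

Lemma move_coord_le (u v : gridG) :
  move u v -> (coord1 v <= coord1 u) || (coord2 v <= coord2 u).
Proof. by case=> [->|/=]; rewrite ?leqnn // grid_adjE; lia. Qed.

Lemma gridG_cop_win : cop_win gridG.
Proof.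
exists (climb (vertexSr 0 0)) => r rP; split; first exact: climb_legal.
by have [k _ ck] := climb_catches (vertexSr 0 0) r rP; exists k.
Qed.

Lemma gridG_catch_within u v :
  @can_catch_within gridG (maxn (coord1 u) (coord2 u)).+2 v u.
Proof.
(* The head of the history is the robber's first move. On the empty history the default is harmless:
   both strategies start at [v]. *)
pose s : strategy gridG := fun h : seq gridV =>
  if coord1 (head v h) <= coord1 u then climb v h else climb_right v h.
have climb_right0 : climb_right v [::] = v by rewrite /climb_right /= swapK.
exists s; split=> [|r ur rP]; first by rewrite /s climb_right0 if_same.
have [le1|gt1] := leqP (coord1 (r 0)) (coord1 u).
  have sE n : cop_play s r n = cop_play (climb v) r n.
    case: n => [|n]; last by rewrite /cop_play /s /= le1.
    by rewrite /cop_play /s climb_right0 if_same.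
  split=> [n|]; first by rewrite !sE; apply: climb_legal.
  right; have [k lek ck] := climb_catches v r rP; exists k; first by lia.
  by rewrite /caught_at !sE.
have sE n : cop_play s r n = cop_play (climb_right v) r n.
  case: n => [|n]; last by rewrite /cop_play /s /= leqNgt gt1.
  by rewrite /cop_play /s climb_right0 if_same.
split=> [n|]; first by rewrite !sE; apply: climb_right_legal.
right; have [k lek ck] := climb_right_catches v r rP; exists k.
  by have := move_coord_le _ _ ur; lia.
by rewrite /caught_at !sE.
Qed.

(** The second test of the guard makes the reply legal for all [u] and [v], even near the axes. *)
Definition escape u v : gridV :=
  let w := if coord1 u < coord1 v then vertexSl (coord1 v) (coord2 u).-1
           else vertexSr (coord1 u).-1 (coord2 v) in
  if grid_adj u v && grid_adj u w then w else u.

Lemma escape_move u v : @move gridG u (escape u v).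
Proof. by rewrite /escape; case: ifP => [/andP[]|]; [right | left]. Qed.

(** Off the axes, an adjacent cop exceeds the robber in one coordinate and is below him in the
    other. The new vertex exceeds the cop in the former, is at least level with him in the latter,
    and avoids the axes. *)
Lemma escape_safe m u v : u <> v -> m.+1 < coord1 u -> m.+1 < coord2 u ->
  [/\ ~ @move gridG v (escape u v), m < coord1 (escape u v)
    & m < coord2 (escape u v)].
Proof.
move=> neq l1 l2; rewrite /escape; case: ifPn => [/andP[+ _]|].
  rewrite grid_adjE; case: ifP => lt uv.
    split; rewrite ?coordE; try lia.
    case=> [e|]; last first.
      by rewrite /= grid_adjE !coordE; lia.
    by move: (congr1 coord1 e); rewrite !coordE; lia.
  split; rewrite ?coordE; try lia.
  case=> [e|]; last first.
    by rewrite /= grid_adjE !coordE; lia.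
  by move: (congr1 coord2 e); rewrite !coordE; lia.
(* Here a threat would make the whole guard true, so its failure means that the cop is not
   adjacent. *)
move=> H; split; [|lia|lia]; case=> [/esym//|]; move: H.
rewrite /= grid_adj_sym !grid_adjE; case: ifP => lt;
by rewrite ?coordE; lia.
Qed.

(** The cop may use the whole past, so the play is built as a history; [last u] gives [u] before the
    first move. *)
Fixpoint escape_history (s : strategy gridG) u n : seq gridV :=
  if n is m.+1 then
    let h := escape_history s u m in rcons h (escape (last u h) (s h))
  else [::].

Definition escape_play s u n : gridV := last u (escape_history s u n.+1).

Lemma mkseq_escape_play s u n :
  mkseq (escape_play s u) n = escape_history s u n.
Proof.
elim: n => // n IHn.
by rewrite mkseqS IHn /escape_play /= last_rcons.
Qed.

Lemma escape_playE s u n :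
  escape_play s u n =
  escape (last u (escape_history s u n)) (cop_play s (escape_play s u) n).
Proof. by rewrite /cop_play mkseq_escape_play /escape_play /= last_rcons. Qed.

Lemma escape_robber_play s u : @robber_play gridG (escape_play s u).
Proof. by move=> n; rewrite (escape_playE s u n.+1); apply: escape_move. Qed.

(** This is the state just before the robber's turn [k]; each turn costs one unit of margin. *)
Lemma escape_invariant (s : strategy gridG) u n k :
  legal_against s (escape_play s u) -> u <> s [::] ->
  n.+1 < coord1 u -> n.+1 < coord2 u -> k <= n ->
  let c := cop_play s (escape_play s u) in
  let w := last u (escape_history s u k) in
  [/\ w <> c k, (n - k).+1 < coord1 w & (n - k).+1 < coord2 w].
Proof.
move=> legal neq l1 l2 + c; elim: k => [|k IHk] kn w; first by rewrite subn0.
have [nw m1 m2] := IHk (ltnW kn).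
have [||nm m3 m4] := escape_safe (n - k) _ _ nw; [lia|lia|].
have ->: w = escape_play s u k by [].
rewrite escape_playE -/c; split; [|lia|lia] => e.
by apply: nm; rewrite e; apply: legal.
Qed.

Lemma gridG_escape n : exists u v, ~ @can_catch_within gridG n v u.
Proof.
pose u := vertexSl n.+1 n.+2; pose v := vertexSl 0 0.
have nuv : u <> v by move/(congr1 coord1).
exists u, v => -[s [sv sP]].
have [||legal] := sP (escape_play s u).
- by rewrite escape_playE; apply: escape_move.
- exact: escape_robber_play.
case=> [/esym//|[k kn]].
have inv := escape_invariant s u n _ legal.
rewrite sv in inv.
have [] := inv k nuv (ltnSn _) (ltnSn _) (ltnW kn).
(* Capture by the cop's reply contradicts the invariant at [k.+1]; a robber stepping onto the cop
   contradicts [escape_safe], since staying put is a move. *)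
move=> nw l1 l2; case=> e; last first.
  have [nw' _ _] := inv k.+1 nuv (ltnSn _) (ltnSn _) kn.
  by apply: nw'; rewrite e.
have [||nm _ _] := escape_safe (n - k) _ _ nw; [lia|lia|].
by apply: nm; rewrite -escape_playE -e; left.
Qed.

Theorem theorem2 :
  cop_win gridG /\
  (forall u v : gridG, exists n : nat, can_catch_within n v u) /\
  ~ (exists n : nat, forall u v : gridG, can_catch_within n v u).
Proof.
split; first exact: gridG_cop_win.
split=> [u v|[n all_n]].
  by exists (maxn (coord1 u) (coord2 u)).+2; apply: gridG_catch_within.
by have [u [v]] := gridG_escape n; apply.
Qed.
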